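(* Let $a,b$ be complex numbers with $|ab|<1$. Then $$\frac{(q,ab;q)_\infty}{(qa,qb;q)_\infty}\sum_{n=0}^\infty\frac{(q/a,q/b;q)_n(-ab)^n}{(q^2;q^2)_n} =\sum_{n=0}^\infty\sum_{j=-n}^n(-1)^j\frac{(1-q^{2n+1})(q/a,q/b;q)_n(ab)^nq^{n^2-j^2}}{(qa,qb;q)_n}.$$
   Context: Throughout $0<q<1$. For a base $p\in\{q,q^2\}$ put $(x;p)_0=1$, $(x;p)_n=\prod_{k=0}^{n-1}(1-xp^k)$, $(x;p)_\infty=\prod_{k\ge0}(1-xp^k)$, and $(x,y;p)_n=(x;p)_n(y;p)_n$ for $n$ a nonnegative integer or $\infty$. The double sum is read as an outer sum over $n$ of the finite inner sums over $j$. Parameters are assumed such that no denominator vanishes, i.e. $a,b\notin\{q^{-k}:k\ge1\}$. The values $a=0$ or $b=0$ are allowed, with $(q/a;q)_na^n$ read by continuity as $\prod_{k=1}^n(a-q^k)$, and similarly for $b$. *)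

(* Defs.v *)
From Stdlib Require Import Reals ZArith Lra Lia.
From Coquelicot Require Import Coquelicot.

Open Scope C_scope.

(* (x;p)_n *)
Fixpoint qpoch (x : C) (p : R) (n : nat) : C :=
  match n with
  | O => 1
  | S k => qpoch x p k * (1 - x * p ^ k)
  end.

(* (x;p)_oo.  [Lim_seq] is total, so this is meaningful only when the finite
   products converge; see [qpoch_inf_correct]. *)
Definition qpoch_inf (x : C) (p : R) : C :=
  (real (Lim_seq (fun n => Re (qpoch x p n))),
   real (Lim_seq (fun n => Im (qpoch x p n)))).

(* prod_{k=1}^n (a - q^k) *)
Fixpoint shifted_prod (a : C) (q : R) (n : nat) : C :=
  match n with
  | O => 1
  | S k => shifted_prod a q k * (a - q ^ S k)
  end.

(* (q/a;q)_n a^n, extended to a = 0 by continuity in a; the two branches are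
   reconciled by [qpoch_pow_eq]. *)
Definition qpoch_pow (a : C) (q : R) (n : nat) : C :=
  if Ceq_dec a 0 then shifted_prod a q n else qpoch (q / a) q n * a ^ n.

(* (q/a,q/b;q)_n (-ab)^n / (q^2;q^2)_n *)
Definition lhs_term (a b : C) (q : R) (n : nat) : C :=
  qpoch_pow a q n * qpoch_pow b q n * (-1) ^ n
  / qpoch (q ^ 2)%R (q ^ 2)%R n.

(* sum_{j=-n}^{n} (-1)^j (1-q^(2n+1)) (q/a,q/b;q)_n (ab)^n q^(n^2-j^2)
   / (qa,qb;q)_n, with j = i - n for 0 <= i <= 2n *)
Definition rhs_term (a b : C) (q : R) (n : nat) : C :=
  sum_n (fun i : nat =>
    let j := (Z.of_nat i - Z.of_nat n)%Z in
    powerRZ (-1) j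
    * ((1 - q ^ (2 * n + 1)) * (qpoch_pow a q n * qpoch_pow b q n)
       * powerRZ q (Z.of_nat n ^ 2 - j ^ 2))
    / (qpoch (q * a) q n * qpoch (q * b) q n)) (2 * n).

Lemma qpoch_pow_eq (a : C) (q : R) (n : nat) :
  qpoch_pow a q n = shifted_prod a q n.
Proof.
unfold qpoch_pow; destruct (Ceq_dec a 0) as [_ | Ha]; [reflexivity|].
induction n as [|n IH]; [simpl; ring|].
cbn [qpoch shifted_prod]; rewrite <- IH, !Cpow_S; field; exact Ha.
Qed.

Lemma Cmod_qpoch_le (x : C) (p : R) (n : nat) : (0 <= p < 1)%R ->
  (Cmod (qpoch x p n) <= exp (Cmod x / (1 - p)))%R.
Proof.
intros Hp.
assert (Hx := Cmod_ge_0 x).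
apply Rle_trans with (exp (Cmod x * ((1 - p ^ n) / (1 - p)))).
- induction n as [|n IH].
  + simpl; rewrite Cmod_1.
    replace (Cmod x * ((1 - 1) / (1 - p)))%R with 0%R by (field; lra).
    rewrite exp_0; lra.
  + cbn [qpoch]; rewrite Cmod_mult.
    replace (Cmod x * ((1 - p ^ S n) / (1 - p)))%R
      with (Cmod x * ((1 - p ^ n) / (1 - p)) + Cmod x * p ^ n)%R
      by (simpl; field; lra).
    rewrite exp_plus.
    apply Rmult_le_compat; try apply Cmod_ge_0; [exact IH|].
    apply Rle_trans with (1 + Cmod x * p ^ n)%R; [|apply exp_ineq1_le].
    unfold Cminus; eapply Rle_trans; [apply Cmod_triangle|].
    rewrite Cmod_1, Cmod_opp, Cmod_mult, <- RtoC_pow, Cmod_R.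
    rewrite Rabs_pos_eq; [lra | apply pow_le; lra].
- assert (Hle : (Cmod x * ((1 - p ^ n) / (1 - p)) <= Cmod x / (1 - p))%R).
  { unfold Rdiv; apply Rmult_le_compat_l; [exact Hx|].
    rewrite <- (Rmult_1_l (/ (1 - p))) at 2.
    apply Rmult_le_compat_r; [left; apply Rinv_0_lt_compat; lra|].
    assert (0 <= p ^ n)%R by (apply pow_le; lra); lra. }
  destruct Hle as [Hlt | ->]; [left; now apply exp_increasing | right; reflexivity].
Qed.

Lemma qpoch_inf_correct (x : C) (p : R) : (0 <= p < 1)%R ->
  filterlim (qpoch x p) eventually (locally (qpoch_inf x p)).
Proof.
intros Hp.
set (d := fun n : nat => (- (qpoch x p n * (x * p ^ n)))%C).
assert (Hd : ex_series (V := C_CompleteNormedModule) d).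
{ apply (ex_series_le (V := C_CompleteNormedModule) d
    (fun n => (exp (Cmod x / (1 - p)) * Cmod x) * p ^ n)%R).
  - intros n; change (Cmod (d n)
      <= exp (Cmod x / (1 - p)) * Cmod x * p ^ n)%R.
    unfold d; rewrite Cmod_opp, !Cmod_mult, <- RtoC_pow, Cmod_R.
    rewrite (Rabs_pos_eq (p ^ n)); [|apply pow_le; lra].
    rewrite <- Rmult_assoc.
    apply Rmult_le_compat_r; [apply pow_le; lra|].
    apply Rmult_le_compat_r; [apply Cmod_ge_0|].
    now apply Cmod_qpoch_le.
  - apply (ex_series_scal_l (K := R_AbsRing) (V := R_NormedModule)).
    apply ex_series_geom; rewrite Rabs_pos_eq; lra. }
destruct Hd as [l Hl].
assert (Hsum : forall n, sum_n d n = qpoch x p (S n) - 1).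
{ induction n as [|n IH].
  - rewrite sum_O; unfold d; simpl; ring.
  - rewrite sum_Sn, IH; unfold d; change plus with Cplus.
    cbn [qpoch]; match goal with |- ?u = ?v => change (@eq C u v) end; ring. }
assert (HRe : is_lim_seq (fun n => Re (qpoch x p n)) (Re l + 1)%R).
{ apply is_lim_seq_incr_1.
  apply is_lim_seq_ext with (fun n => Re (sum_n d n) + 1)%R.
  - intros n; rewrite Hsum; unfold Re, Cminus, Cplus, Copp, RtoC; simpl; ring.
  - apply is_lim_seq_plus'; [|apply is_lim_seq_const].
    intros P HP; destruct HP as [e He].
    destruct (Hl (ball (M := C_UniformSpace) l e)) as [N HN];
      [now exists e|].
    exists N; intros n Hn; apply He, (HN n Hn). }
assert (HIm : is_lim_seq (fun n => Im (qpoch x p n)) (Im l)).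
{ apply is_lim_seq_incr_1.
  apply is_lim_seq_ext with (fun n => Im (sum_n d n)).
  - intros n; rewrite Hsum; unfold Im, Cminus, Cplus, Copp, RtoC; simpl; ring.
  - intros P HP; destruct HP as [e He].
    destruct (Hl (ball (M := C_UniformSpace) l e)) as [N HN];
      [now exists e|].
    exists N; intros n Hn; apply He, (HN n Hn). }
unfold qpoch_inf.
rewrite (is_lim_seq_unique _ _ HRe), (is_lim_seq_unique _ _ HIm); simpl.
intros P [e He].
destruct (HRe (ball (M := R_UniformSpace) (Re l + 1)%R e)) as [N1 HN1];
  [now exists e|].
destruct (HIm (ball (M := R_UniformSpace) (Im l) e)) as [N2 HN2];
  [now exists e|].
exists (max N1 N2); intros n Hn; apply He; split.
- apply HN1; lia.
- apply HN2; lia.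
Qed.

(* Main.v *)
Require Import Defs.
From Stdlib Require Import Reals ZArith Lra Lia.
From Coquelicot Require Import Coquelicot.
Open Scope C_scope.

(** The identity is an instance of Bailey's lemma. Write (x)_n for (x;q)_n
    and w_r = sum_{|j|<=r} (-1)^j q^(r^2-j^2). Three finite facts are combined.

    First, a Bailey pair ([bailey_pair]):
      sum_{r<=n} (1-q^(2r+1)) w_r / ((q)_{n-r} (q)_{n+r+1})
        = (-1)^n / (q^2;q^2)_n.
    With V_r = 1/((q)_{n-r} (q)_{n+r}) one has
      (1-q^(2r+1)) / ((q)_{n-r} (q)_{n+r+1}) = V_r - q^(2r+1) V_{r+1},
    and w_{r+1} = q^(2r+1) w_r + 2 (-1)^(r+1), so the left side telescopes to
    sum_{|j|<=n} (-1)^j / ((q)_{n-j} (q)_{n+j}), an alternating sum of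
    q-binomial coefficients over (q)_{2n}, which Gauss evaluated
    ([gauss_sum_even]).

    Secondly, the q-Pfaff-Saalschutz sum ([saalschutz]), which evaluates the
    inner sum obtained when the Bailey pair is inserted in
      sum_{n<=N} (q/a)_n (q/b)_n (-ab)^n / (q^2;q^2)_n * (ab)_{N-n}/(q)_{N-n}
    and the two summations are exchanged. The result, [finite_identity], is a
    terminating form of the theorem, valid for every N.

    Finally N tends to infinity. Up to the factor (qa)_N (qb)_N, both sides are
    sums over n <= N of a summable sequence times a bounded factor that
    converges for fixed n, so Tannery's theorem ([tannery]) applies: on the left the factor (ab)_{N-n}/(q)_{N-n}
    tends to (ab)_oo/(q)_oo, and on the right 1/((q)_{N-r} (q)_{N+r+1}) tends
    to 1/(q)_oo^2. Summability comes from [shifted_prod_bound], a geometric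
    bound of ratio below 1, and boundedness of the reciprocals
    from [qpoch_bounded_below].

    Throughout, (q/a)_n a^n is used in its polynomial form [shifted_prod], so
    a = 0 and b = 0 need no separate treatment. *)

(** * Finite sums of complex numbers *)

(* [sum_n] lands in the carrier of an abstract structure; these restatements
   keep every equation in [C], where [ring] and [field] apply. *)
Lemma csum_O (f : nat -> C) : sum_n f 0 = f O :> C.
Proof. exact (sum_O f). Qed.

Lemma csum_S (f : nat -> C) (n : nat) : sum_n f (S n) = sum_n f n + f (S n) :> C.
Proof. exact (sum_Sn f n). Qed.

Lemma csum_ext (f g : nat -> C) (n : nat) :
  (forall k, (k <= n)%nat -> f k = g k) -> sum_n f n = sum_n g n :> C.
Proof. exact (sum_n_ext_loc f g n). Qed.

Lemma csum_plus (f g : nat -> C) (n : nat) :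
  sum_n (fun k => f k + g k) n = sum_n f n + sum_n g n :> C.
Proof. exact (sum_n_plus f g n). Qed.

Lemma csum_scal (c : C) (f : nat -> C) (n : nat) :
  sum_n (fun k => c * f k) n = c * sum_n f n :> C.
Proof. exact (sum_n_mult_l (K := C_Ring) c f n). Qed.

Lemma csum_minus (f g : nat -> C) (n : nat) :
  sum_n (fun k => f k - g k) n = sum_n f n - sum_n g n :> C.
Proof.
rewrite (csum_ext _ (fun k => f k + -(1) * g k)) by (intros; ring).
rewrite csum_plus, csum_scal; ring.
Qed.

Lemma csum_first (f : nat -> C) (n : nat) :
  sum_n f (S n) = f O + sum_n (fun k => f (S k)) n :> C.
Proof.
induction n as [|n IH]; [rewrite csum_S, !csum_O; ring|].
rewrite csum_S, IH, csum_S; ring.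
Qed.

(** Removing both ends of a centred range -n-1..n+1, stored as 0..2n+2,
    leaves the range -n..n; inductions on symmetric sums use this step. *)
Lemma csum_peel (f : nat -> C) (n : nat) :
  sum_n f (2 * S n) = f O + sum_n (fun k => f (S k)) (2 * n) + f (2 * S n)%nat :> C.
Proof.
replace (2 * S n)%nat with (S (S (2 * n))) by lia.
rewrite csum_S, csum_first; reflexivity.
Qed.

Lemma csum_triangle (f : nat -> nat -> C) (N : nat) :
  sum_n (fun n => sum_n (f n) n) N
  = sum_n (fun r => sum_n (fun m => f (r + m)%nat r) (N - r)) N :> C.
Proof.
induction N as [|N IH]; [now rewrite !csum_O|].
rewrite csum_S, IH, csum_S, csum_S, Nat.sub_diag, csum_O, Nat.add_0_r.
rewrite Cplus_assoc, <- csum_plus; f_equal.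
apply csum_ext; intros r Hr.
replace (S N - r)%nat with (S (N - r)) by lia.
rewrite csum_S; do 2 f_equal; lia.
Qed.

(** * Finite products *)

Lemma qpoch_S (x : C) (p : R) (n : nat) :
  qpoch x p (S n) = qpoch x p n * (1 - x * p ^ n).
Proof. reflexivity. Qed.

Lemma qpoch_S_l (x : C) (p : R) (n : nat) :
  qpoch x p (S n) = (1 - x) * qpoch (x * p) p n.
Proof.
induction n as [|n IH]; [simpl; ring|].
rewrite qpoch_S, IH, qpoch_S, Cpow_S; ring.
Qed.

Lemma qpoch_add (x : C) (p : R) (m n : nat) :
  qpoch x p (m + n) = qpoch x p m * qpoch (x * p ^ m) p n.
Proof.
induction n as [|n IH]; [rewrite Nat.add_0_r; simpl; ring|].
rewrite Nat.add_succ_r, !qpoch_S, IH, Cpow_add_r; ring.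
Qed.

Lemma qpoch_neq_0 (x : C) (p : R) (n : nat) :
  (forall k, 1 - x * p ^ k <> 0) -> qpoch x p n <> 0.
Proof.
intros Hx; induction n as [|n IH]; [exact C1_nz|].
rewrite qpoch_S; apply Cmult_neq_0; auto.
Qed.

Lemma one_minus_pow_neq_0 (q : R) (k : nat) :
  (0 < q < 1)%R -> 1 - (q : C) ^ S k <> 0.
Proof.
intros Hq H; rewrite <- RtoC_pow, <- RtoC_minus in H.
apply RtoC_inj in H.
assert (q ^ S k < 1)%R by (apply pow_lt_1_compat; [lra | lia]); lra.
Qed.

Lemma qfact_neq_0 (q : R) (n : nat) : (0 < q < 1)%R -> qpoch q q n <> 0.
Proof.
intros Hq; apply qpoch_neq_0; intros k; rewrite <- Cpow_S.
now apply one_minus_pow_neq_0.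
Qed.

(** The tail prod_{r<k<=r+m} (a - q^k) is again a product of this kind once
    q^r is taken out of each factor; this turns a shifted summation into the
    unshifted Saalschutz sum with a and b divided by q^r. *)
Lemma shifted_prod_add (a : C) (q : R) (r m : nat) : (0 < q)%R ->
  shifted_prod a q (r + m)
  = shifted_prod a q r * (((q : C) ^ r) ^ m * shifted_prod (a / q ^ r) q m).
Proof.
intros Hq.
assert (Hr : (q : C) ^ r <> 0)
  by (apply Cpow_nz; intros H; apply RtoC_inj in H; lra).
induction m as [|m IH]; [rewrite Nat.add_0_r; simpl; ring|].
rewrite Nat.add_succ_r; cbn [shifted_prod]; rewrite IH.
rewrite <- Nat.add_succ_r, Cpow_add_r, (Cpow_S (_ ^ r) m).
field; exact Hr.
Qed.

(** * The q-Pfaff-Saalschutz sum *)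

(** Up to a factor free of m, the usual summand of a balanced terminating
    3phi2, with its numerator parameters q/a and q/b absorbed into the polynomial products; c is the
    free parameter, which will be q^(2r). *)
Definition saalschutz_term (a b c : C) (q : R) (M m : nat) : C :=
  shifted_prod a q m * shifted_prod b q m * c ^ m * qpoch (c * (a * b)) q (M - m)
  / (qpoch q q (M - m) * qpoch q q m * qpoch (c * q ^ 2) q m).

(** A Wilf-Zeilberger certificate. If S_M is the sum over m <= M, then
      S_{M+1} (1-q^(M+1)) (1-cq^(M+2)) = S_M (1-cq^(M+1)a) (1-cq^(M+1)b),
    because the corresponding combination of summands telescopes in m; the
    right side here is what it telescopes to. At j = M it is minus the
    remaining contribution, that of the term m = M+1 of S_{M+1}. *)
Lemma saalschutz_telescope (a b c : C) (q : R) (M j : nat) :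
  (0 < q < 1)%R -> (forall k, 1 - c * q ^ 2 * q ^ k <> 0) -> (j <= M)%nat ->
  sum_n (fun m =>
      (1 - q ^ S M) * (1 - c * q ^ 2 * q ^ M) * saalschutz_term a b c q (S M) m
      - (1 - c * q ^ S M * a) * (1 - c * q ^ S M * b) * saalschutz_term a b c q M m) j
  = - (q ^ (M - j) * shifted_prod a q (S j) * shifted_prod b q (S j) * c ^ S j
       * qpoch (c * (a * b)) q (M - j))
    / (qpoch q q (M - j) * qpoch q q j * qpoch (c * q ^ 2) q j) :> C.
Proof.
intros Hq Hc; unfold saalschutz_term.
replace ((q : C) ^ 2) with ((q : C) * q) in * by ring.
assert (Hf := fun n => qfact_neq_0 q n Hq).
assert (H1 : forall n, 1 - (q : C) * q ^ n <> 0)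
  by (intros n; rewrite <- Cpow_S; now apply one_minus_pow_neq_0).
assert (H2 := fun n => qpoch_neq_0 (c * (q * q)) q n Hc).
induction j as [|j IH]; intros Hj.
- rewrite csum_O; rewrite !Nat.sub_0_r, !qpoch_S, !Cpow_S.
  cbn [qpoch shifted_prod Cpow].
  specialize (Hf M); specialize (H1 M).
  generalize dependent (qpoch q q M); intros P HP.
  generalize dependent ((q : C) ^ M); intros Q HQ.
  field; auto.
- rewrite csum_S, IH by lia.
  destruct (Nat.le_exists_sub (S j) M Hj) as [d [-> _]].
  replace (d + S j - j)%nat with (S d) by lia.
  replace (S (d + S j) - S j)%nat with (S d) by lia.
  replace (d + S j - S j)%nat with d by lia.
  cbn [shifted_prod]; rewrite !qpoch_S, !Cpow_S, !Cpow_add_r, !Cpow_S.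
  assert (E1 := H1 d). assert (E2 := H1 j). assert (E3 := Hc j).
  generalize (Hf d) (Hf j) (H2 j).
  generalize dependent ((q : C) ^ d); intros D E1.
  generalize dependent ((q : C) ^ j); intros J E2 E3.
  generalize (shifted_prod a q j) (shifted_prod b q j)
     (qpoch (c * (a * b)) q d) (qpoch q q d) (qpoch q q j)
     (qpoch (c * (q * q)) q j) (c ^ j).
  intros; field; repeat split; auto.
Qed.

Lemma saalschutz (a b c : C) (q : R) (M : nat) :
  (0 < q < 1)%R -> (forall k, 1 - c * q ^ 2 * q ^ k <> 0) ->
  sum_n (saalschutz_term a b c q M) M
  = qpoch (c * q * a) q M * qpoch (c * q * b) q M
    / (qpoch q q M * qpoch (c * q ^ 2) q M) :> C.
Proof.
intros Hq Hc; assert (Ht := saalschutz_telescope a b c q).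
replace ((q : C) ^ 2) with ((q : C) * q) in * by ring.
assert (Hf := fun n => qfact_neq_0 q n Hq).
assert (H1 : forall n, 1 - (q : C) ^ S n <> 0)
  by (intros n; now apply one_minus_pow_neq_0).
assert (H2 := fun n => qpoch_neq_0 (c * (q * q)) q n Hc).
induction M as [|M IH].
- rewrite csum_O; unfold saalschutz_term; simpl; field.
- assert (T := Ht M M Hq Hc (le_n M)).
  rewrite csum_minus, !csum_scal, IH in T; rewrite csum_S.
  set (X := sum_n (saalschutz_term a b c q (S M)) M) in *.
  assert (EX : X = (((1 - c * q ^ S M * a) * (1 - c * q ^ S M * b)) *
    (qpoch (c * q * a) q M * qpoch (c * q * b) q M
    / (qpoch q q M * qpoch (c * (q * q)) q M)) +
    - (q ^ (M - M) * shifted_prod a q (S M) * shifted_prod b q (S M) * c ^ S M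
       * qpoch (c * (a * b)) q (M - M))
    / (qpoch q q (M - M) * qpoch q q M * qpoch (c * (q * q)) q M))
    / ((1 - q ^ S M) * (1 - c * (q * q) * q ^ M)) :> C).
  { rewrite <- T; symmetry; field; auto. }
  rewrite EX; unfold saalschutz_term; rewrite !Nat.sub_diag, !qpoch_S.
  replace ((q : C) ^ 2) with ((q : C) * q) in * by ring.
  cbn [qpoch]; rewrite <- Cpow_S.
  generalize (Hf M) (H1 M) (H2 M) (Hc M).
  generalize (shifted_prod a q (S M)) (shifted_prod b q (S M)) (c ^ S M)
    (qpoch q q M) (qpoch (c * (q * q)) q M).
  intros; rewrite !Cpow_S in *; field; repeat split; auto.
Qed.

(** * Gauss's alternating sum *)

(** (-1)^k times the q-binomial coefficient of N over k, divided by (q)_N. *)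
Definition gauss_term (q : R) (N k : nat) : C :=
  (-1) ^ k / (qpoch q q k * qpoch q q (N - k)).

(** 1-q^k cancels the last factor of (q)_k, which shifts the index k. *)
Lemma gauss_lower (q : R) (N : nat) : (0 < q < 1)%R ->
  sum_n (fun k => (1 - q ^ k) * gauss_term q (S N) k) (S N)
  = - sum_n (gauss_term q N) N :> C.
Proof.
intros Hq; rewrite csum_first, (csum_ext _ (fun k => -(1) * gauss_term q N k)).
- rewrite csum_scal; simpl Cpow; ring.
- intros k Hk; unfold gauss_term; rewrite qpoch_S, Nat.sub_succ, !Cpow_S.
  assert (H1 := one_minus_pow_neq_0 q k Hq); rewrite Cpow_S in H1.
  field; auto using qfact_neq_0.
Qed.

(** 1-q^(N+1-k) cancels the last factor of (q)_{N+1-k}, without a shift. *)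
Lemma gauss_upper (q : R) (N : nat) : (0 < q < 1)%R ->
  sum_n (fun k => (1 - q ^ (S N - k)) * (q ^ k * gauss_term q (S N) k)) (S N)
  = sum_n (fun k => q ^ k * gauss_term q N k) N :> C.
Proof.
intros Hq; rewrite csum_S, Nat.sub_diag; change ((q : C) ^ 0) with (RtoC 1).
rewrite (csum_ext _ (fun k => q ^ k * gauss_term q N k)); [ring|].
intros k Hk; unfold gauss_term.
replace (S N - k)%nat with (S (N - k)) by lia.
assert (H1 := one_minus_pow_neq_0 q (N - k) Hq); rewrite Cpow_S in H1.
rewrite qpoch_S, !Cpow_S; field; auto using qfact_neq_0.
Qed.

(** Split 1-q^(N+2) = (1-q^k) + q^k (1-q^(N+2-k)). The two parts give
    -G_{N+1} and sum_k q^k g(N+1,k), where g is [gauss_term] and G_N the full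
    sum; together they are -sum_k (1-q^k) g(N+1,k), which is G_N by one more
    use of [gauss_lower]. *)
Lemma gauss_sum_rec (q : R) (N : nat) : (0 < q < 1)%R ->
  (1 - q ^ S (S N)) * sum_n (gauss_term q (S (S N))) (S (S N))
  = sum_n (gauss_term q N) N :> C.
Proof.
intros Hq.
rewrite <- csum_scal.
rewrite (csum_ext _ (fun k => (1 - q ^ k) * gauss_term q (S (S N)) k
   + (1 - q ^ (S (S N) - k)) * (q ^ k * gauss_term q (S (S N)) k))).
- rewrite csum_plus, gauss_lower, gauss_upper by assumption.
  assert (E := gauss_lower q N Hq).
  rewrite (csum_ext _ (fun k => gauss_term q (S N) k
     - q ^ k * gauss_term q (S N) k)) in E by (intros; ring).
  rewrite csum_minus in E.
  change (sum_n (fun k => gauss_term q (S N) k) (S N))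
    with (sum_n (gauss_term q (S N)) (S N)) in E.
  replace (sum_n (gauss_term q N) N)
    with (- - sum_n (gauss_term q N) N) by ring.
  rewrite <- E; ring.
- intros k Hk.
  replace ((q : C) ^ S (S N)) with ((q : C) ^ k * q ^ (S (S N) - k))
    by (rewrite <- Cpow_add_r; f_equal; lia).
  ring.
Qed.

Lemma gauss_sum_even (q : R) (n : nat) : (0 < q < 1)%R ->
  sum_n (gauss_term q (2 * n)) (2 * n) = / qpoch (q ^ 2)%R (q ^ 2) n :> C.
Proof.
intros Hq; induction n as [|n IH].
- simpl (2 * 0)%nat; rewrite csum_O; unfold gauss_term; simpl; field.
- replace (2 * S n)%nat with (S (S (2 * n))) by lia.
  rewrite qpoch_S.
  replace (RtoC (q ^ 2) * RtoC (q ^ 2) ^ n) with ((q : C) ^ S (S (2 * n)))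
    by (rewrite RtoC_pow, <- Cpow_mult_r, <- Cpow_add_r; f_equal; lia).
  assert (H1 := one_minus_pow_neq_0 q (S (2 * n)) Hq).
  assert (H2 : qpoch (q ^ 2)%R (q ^ 2) n <> 0).
  { apply qpoch_neq_0; intros k.
    rewrite <- Cpow_S, RtoC_pow, <- Cpow_mult_r.
    replace (2 * S k)%nat with (S (2 * k + 1)) by lia.
    now apply one_minus_pow_neq_0. }
  assert (E := gauss_sum_rec q (2 * n) Hq); rewrite IH in E.
  transitivity (/ qpoch (q ^ 2)%R (q ^ 2) n / (1 - q ^ S (S (2 * n)))).
  - rewrite <- E; symmetry; field; exact H1.
  - field; auto.
Qed.

(** * The Bailey pair *)

(** The truncated theta function sum_{|j|<=n} (-1)^j q^(n^2-j^2). *)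
Definition theta_trunc (q : R) (n : nat) : C :=
  sum_n (fun i : nat => let j := (Z.of_nat i - Z.of_nat n)%Z in
    RtoC (powerRZ (-1) j * powerRZ q (Z.of_nat n ^ 2 - j ^ 2))) (2 * n).

Lemma theta_trunc_O (q : R) : theta_trunc q 0 = 1.
Proof.
unfold theta_trunc; simpl (2 * 0)%nat; rewrite csum_O; simpl; f_equal; ring.
Qed.

(** The terms |j| <= n only gain the factor q^((n+1)^2-n^2), and the two new
    terms j = n+1, -n-1 are equal to (-1)^(n+1). *)
Lemma theta_trunc_S (q : R) (n : nat) : (0 < q)%R ->
  theta_trunc q (S n)
  = q ^ (2 * n + 1) * theta_trunc q n + 2 * (-1) ^ S n.
Proof.
intros Hq; unfold theta_trunc; rewrite csum_peel.
rewrite <- csum_scal.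
set (s := (-1) ^ S n).
assert (E0 : forall j, j = Z.of_nat (S n) \/ j = (- Z.of_nat (S n))%Z ->
  RtoC (powerRZ (-1) j * powerRZ q (Z.of_nat (S n) ^ 2 - j ^ 2)) = s).
{ intros j Hj.
  replace (Z.of_nat (S n) ^ 2 - j ^ 2)%Z with 0%Z by (destruct Hj; subst; ring).
  rewrite Rmult_1_r; unfold s; rewrite <- RtoC_pow; f_equal.
  destruct Hj as [-> | ->]; [now rewrite pow_powerRZ|].
  rewrite powerRZ_neg', <- pow_powerRZ, <- pow_inv; f_equal; lra. }
cbv zeta; rewrite !E0 by lia.
rewrite (csum_ext _ (fun i => q ^ (2 * n + 1) *
  RtoC (powerRZ (-1) (Z.of_nat i - Z.of_nat n)
   * powerRZ q (Z.of_nat n ^ 2 - (Z.of_nat i - Z.of_nat n) ^ 2)))); [ring|].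
intros i _.
rewrite <- RtoC_pow, <- RtoC_mult; f_equal.
rewrite (pow_powerRZ q).
replace (Z.of_nat (S i) - Z.of_nat (S n))%Z with (Z.of_nat i - Z.of_nat n)%Z by lia.
replace (Z.of_nat (S n) ^ 2 - (Z.of_nat i - Z.of_nat n) ^ 2)%Z
  with (Z.of_nat (2 * n + 1) + (Z.of_nat n ^ 2 - (Z.of_nat i - Z.of_nat n) ^ 2))%Z
  by lia.
rewrite powerRZ_add by lra; ring.
Qed.

(** Partial sums up to m of the Bailey pair relation for n = m+d. The
    remainder is q^(2m+1) w_m V_{m+1}, with V_{m+1} written as
    (1-q^d)/((q)_d (q)_{d+2m+1}): this form stays meaningful for d = 0, where
    it vanishes and leaves Gauss's sum. *)
Lemma bailey_telescope (q : R) (m d : nat) : (0 < q < 1)%R ->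
  sum_n (fun r => (1 - q ^ (2 * r + 1)) * theta_trunc q r
     / (qpoch q q (m + d - r) * qpoch q q (m + d + r + 1))) m
  = sum_n (fun i => (-1) ^ m * (-1) ^ i
       / (qpoch q q (d + i) * qpoch q q (d + 2 * m - i))) (2 * m)
    - q ^ (2 * m + 1) * theta_trunc q m * (1 - q ^ d)
      / (qpoch q q d * qpoch q q (d + 2 * m + 1)) :> C.
Proof.
intros Hq.
assert (Hf := fun n => qfact_neq_0 q n Hq).
revert d; induction m as [|m IH]; intros d.
- simpl (2 * 0)%nat; rewrite !csum_O, theta_trunc_O.
  rewrite !Nat.add_0_r, !Nat.sub_0_r, !Nat.add_0_l, Nat.add_1_r, qpoch_S.
  simpl Cpow.
  assert (H1 := one_minus_pow_neq_0 q d Hq); rewrite Cpow_S in H1.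
  field; auto.
- rewrite csum_S.
  rewrite (csum_ext _ (fun r => (1 - q ^ (2 * r + 1)) * theta_trunc q r
     / (qpoch q q (m + S d - r) * qpoch q q (m + S d + r + 1))))
    by (intros r _; now replace (m + S d)%nat with (S m + d)%nat by lia).
  rewrite IH, csum_peel.
  rewrite (csum_ext (fun k => (-1) ^ S m * (-1) ^ S k /
     (qpoch q q (d + S k) * qpoch q q (d + 2 * S m - S k)))
     (fun i => (-1) ^ m * (-1) ^ i
       / (qpoch q q (S d + i) * qpoch q q (S d + 2 * m - i)))).
  2:{ intros k Hk; rewrite !Cpow_S.
      replace (d + S k)%nat with (S d + k)%nat by lia.
      replace (d + 2 * S m - S k)%nat with (S d + 2 * m - k)%nat by lia.
      field; auto. }
  rewrite theta_trunc_S by lra.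
  replace (S m + d - S m)%nat with d by lia.
  replace (d + 2 * S m - 2 * S m)%nat with d by lia.
  rewrite Nat.add_0_r, Nat.sub_0_r.
  replace (S m + d + S m + 1)%nat with (S (S d + 2 * m + 1)) by lia.
  replace (d + 2 * S m + 1)%nat with (S (S d + 2 * m + 1)) by lia.
  replace (d + 2 * S m)%nat with (S d + 2 * m + 1)%nat by lia.
  rewrite !qpoch_S.
  replace ((-1) ^ (2 * S m)) with (RtoC 1)
    by (rewrite Cpow_mult_r; replace ((-1) ^ 2) with (RtoC 1) by ring;
        now rewrite Cpow_1_l).
  simpl ((-1) ^ 0).
  replace ((q : C) ^ (2 * S m + 1)) with (q * (q * (q:C) ^ (2 * m + 1)))
    by (rewrite <- !Cpow_S; f_equal; lia).
  replace ((q : C) ^ (S d + 2 * m + 1)) with (q * (q^d * (q:C) ^ (2 * m + 1)))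
    by (rewrite <- Cpow_add_r, <- !Cpow_S; f_equal; lia).
  assert (H1 := one_minus_pow_neq_0 q d Hq); rewrite Cpow_S in H1.
  assert (H2 := one_minus_pow_neq_0 q (S d + 2 * m + 1) Hq).
  replace ((q : C) ^ S (S d + 2 * m + 1))
    with (q * (q * (q^d * (q:C) ^ (2 * m + 1)))) in H2
    by (rewrite <- Cpow_add_r, <- !Cpow_S; f_equal; lia).
  rewrite !Cpow_S.
  field; auto.
Qed.

Lemma bailey_pair (q : R) (n : nat) : (0 < q < 1)%R ->
  sum_n (fun r => (1 - q ^ (2 * r + 1)) * theta_trunc q r
     / (qpoch q q (n - r) * qpoch q q (n + r + 1))) n
  = (-1) ^ n / qpoch (q ^ 2)%R (q ^ 2) n :> C.
Proof.
intros Hq; assert (E := bailey_telescope q n 0 Hq).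
rewrite Nat.add_0_r in E; rewrite E.
simpl ((q : C) ^ 0).
unfold Cdiv at 3; rewrite <- gauss_sum_even, <- csum_scal by assumption.
rewrite (csum_ext _ (fun k => (-1) ^ n * gauss_term q (2 * n) k)).
- unfold Cdiv; ring.
- intros k _; unfold gauss_term, Cdiv; rewrite !Nat.add_0_l; ring.
Qed.

(** * Bailey's lemma in terminating form *)

(** Saalschutz's sum at c = q^(2r), with a/q^r and b/q^r for a and b: the
    arguments c(a/q^r)(b/q^r) = ab and cq(a/q^r) = a q^(r+1) are then the ones
    wanted. *)
Lemma bailey_kernel (a b : C) (q : R) (r M : nat) : (0 < q < 1)%R ->
  sum_n (fun m => shifted_prod a q (r + m) * shifted_prod b q (r + m)
      * qpoch (a * b) q (M - m)
      / (qpoch q q (M - m) * qpoch q q m * qpoch q q (2 * r + 1 + m))) M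
  = shifted_prod a q r * shifted_prod b q r
    * qpoch (q * a * q ^ r) q M * qpoch (q * b * q ^ r) q M
    / (qpoch q q M * qpoch q q (2 * r + 1 + M)) :> C.
Proof.
intros Hq.
assert (Hf := fun n => qfact_neq_0 q n Hq).
set (z := (q : C) ^ r).
assert (Hz : z <> 0)
  by (apply Cpow_nz; intros H; apply RtoC_inj in H; lra).
assert (Ez : z * z * q ^ 2 = q * q ^ (2 * r + 1)).
{ unfold z; rewrite <- Cpow_S, <- !Cpow_add_r; f_equal; lia. }
assert (Hc : forall k, 1 - z * z * q ^ 2 * q ^ k <> 0).
{ intros k; rewrite Ez, <- Cpow_S, <- Cpow_add_r, Nat.add_succ_l.
  now apply one_minus_pow_neq_0. }
assert (Hg := fun n => qpoch_neq_0 _ q n Hc).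
assert (E := saalschutz (a / z) (b / z) (z * z) q M Hq Hc).
replace (z * z * q * (a / z)) with (q * a * z) in E by (field; exact Hz).
replace (z * z * q * (b / z)) with (q * b * z) in E by (field; exact Hz).
rewrite (csum_ext _ (fun m =>
  (shifted_prod a q r * shifted_prod b q r / qpoch q q (2 * r + 1))
  * saalschutz_term (a / z) (b / z) (z * z) q M m)).
- rewrite csum_scal, E, (qpoch_add q q (2 * r + 1) M), <- Ez.
  field; repeat split; auto.
- intros m _; unfold saalschutz_term.
  rewrite (shifted_prod_add a), (shifted_prod_add b) by lra; fold z.
  replace (z * z * (a / z * (b / z))) with (a * b) by (field; exact Hz).
  rewrite (qpoch_add q q (2 * r + 1) m), <- Ez, (Cpow_mult_l z z).
  field; repeat split; auto.
Qed.

(** Insert the Bailey pair for (-1)^n/(q^2;q^2)_n, exchange the summations,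
    and evaluate the sum over n >= r by [bailey_kernel]. *)
Lemma finite_identity (a b : C) (q : R) (N : nat) : (0 < q < 1)%R ->
  (forall n, qpoch (q * a) q n <> 0) -> (forall n, qpoch (q * b) q n <> 0) ->
  sum_n (fun n => shifted_prod a q n * shifted_prod b q n * (-1) ^ n
      / qpoch (q ^ 2)%R (q ^ 2) n
      * (qpoch (a * b) q (N - n) / qpoch q q (N - n))) N
  = (qpoch (q * a) q N * qpoch (q * b) q N)
    * sum_n (fun r => shifted_prod a q r * shifted_prod b q r
        * (1 - q ^ (2 * r + 1)) * theta_trunc q r
        / (qpoch (q * a) q r * qpoch (q * b) q r)
        * / (qpoch q q (N - r) * qpoch q q (N + r + 1))) N :> C.
Proof.
intros Hq Ha Hb.
assert (Hf := fun n => qfact_neq_0 q n Hq).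
rewrite (csum_ext _ (fun n => sum_n (fun r =>
   shifted_prod a q n * shifted_prod b q n
   * (qpoch (a * b) q (N - n) / qpoch q q (N - n))
   * ((1 - q ^ (2 * r + 1)) * theta_trunc q r
      / (qpoch q q (n - r) * qpoch q q (n + r + 1)))) n)).
2:{ intros n _; rewrite csum_scal, bailey_pair by exact Hq.
    unfold Cdiv; ring. }
rewrite csum_triangle, <- csum_scal.
apply csum_ext; intros r Hr.
rewrite (csum_ext _ (fun m => ((1 - q ^ (2 * r + 1)) * theta_trunc q r) *
   (shifted_prod a q (r + m) * shifted_prod b q (r + m)
      * qpoch (a * b) q (N - r - m)
      / (qpoch q q (N - r - m) * qpoch q q m * qpoch q q (2 * r + 1 + m))))).
2:{ intros m Hm.
    replace (N - (r + m))%nat with (N - r - m)%nat by lia.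
    replace (r + m - r)%nat with m by lia.
    replace (r + m + r + 1)%nat with (2 * r + 1 + m)%nat by lia.
    field; auto. }
rewrite csum_scal, bailey_kernel by exact Hq.
(* (x)_N splits at r, so that the factors up to r cancel. *)
assert (EN : forall x, qpoch x q N = qpoch x q r * qpoch (x * q ^ r) q (N - r))
  by (intros x; rewrite <- qpoch_add; f_equal; lia).
rewrite (EN (q * a)), (EN (q * b)).
replace (N + r + 1)%nat with (2 * r + 1 + (N - r))%nat by lia.
field; auto.
Qed.

(** * Limits of complex sequences *)

(** Convergence is always tested through the real sequence of distances: the
    neighbourhoods of [C] as a product and as a ring with absolute value are
    equivalent but not convertible. *)
Lemma clim_iff_dist (f : nat -> C) (l : C) :
  filterlim f eventually (locally l)
  <-> is_lim_seq (fun n => Cmod (f n - l)) 0%R.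
Proof.
rewrite (filterlim_locally_ball_norm (K := C_AbsRing) (U := C_NormedModule)).
rewrite <- is_lim_seq_spec; unfold is_lim_seq'.
assert (Hd : forall n, Rabs (Cmod (f n - l) - 0) = Cmod (f n - l)).
{ intros n; rewrite Rminus_0_r; apply Rabs_pos_eq, Cmod_ge_0. }
split; intros H eps; destruct (H eps) as [N HN]; exists N; intros n Hn;
  specialize (HN n Hn); [rewrite Hd; exact HN | rewrite Hd in HN; exact HN].
Qed.

Lemma clim_dist_le (f : nat -> C) (l : C) (e : nat -> R) :
  (forall n, Cmod (f n - l) <= e n)%R -> is_lim_seq e 0%R ->
  filterlim f eventually (locally l).
Proof.
intros He H; apply clim_iff_dist.
apply (is_lim_seq_le_le (fun _ => 0%R) _ e); [|apply is_lim_seq_const|exact H].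
intros n; split; [apply Cmod_ge_0 | apply He].
Qed.

Lemma clim_mult (f g : nat -> C) (l m : C) :
  filterlim f eventually (locally l) -> filterlim g eventually (locally m) ->
  filterlim (fun n => f n * g n) eventually (locally (l * m)).
Proof.
intros Hf Hg.
apply clim_iff_dist in Hf; apply clim_iff_dist in Hg.
apply clim_dist_le with (fun n => Cmod (f n - l) * Cmod (g n - m)
  + Cmod (f n - l) * Cmod m + Cmod l * Cmod (g n - m))%R.
- intros n; rewrite <- !Cmod_mult.
  replace (f n * g n - l * m)
    with ((f n - l) * (g n - m) + (f n - l) * m + l * (g n - m)) by ring.
  eapply Rle_trans; [apply Cmod_triangle|].
  apply Rplus_le_compat_r, Cmod_triangle.
- replace 0%R with (0 * 0 + 0 * Cmod m + Cmod l * 0)%R by ring.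
  apply is_lim_seq_plus'; [apply is_lim_seq_plus'|];
    apply is_lim_seq_mult'; auto using is_lim_seq_const.
Qed.

Lemma clim_shift (f : nat -> C) (l : C) (g : nat -> nat) (r : nat) :
  filterlim f eventually (locally l) -> (forall n, (n <= g n + r)%nat) ->
  filterlim (fun n => f (g n)) eventually (locally l).
Proof.
intros Hf Hg; apply (filterlim_comp _ _ _ g f _ eventually); [|exact Hf].
intros P [N HN]; exists (N + r)%nat; intros n Hn; apply HN.
specialize (Hg n); lia.
Qed.

Lemma clim_bounded_below (f : nat -> C) (l : C) (c : R) :
  filterlim f eventually (locally l) -> (forall n, c <= Cmod (f n))%R ->
  (c <= Cmod l)%R.
Proof.
intros Hf Hc; apply clim_iff_dist in Hf.
assert (H : Rbar_le c (0 + Cmod l)%R).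
{ apply (is_lim_seq_le (fun _ => c) (fun n => Cmod (f n - l) + Cmod l)%R).
  - intros n; eapply Rle_trans; [apply (Hc n)|].
    replace (f n) with ((f n - l) + l) at 1 by ring; apply Cmod_triangle.
  - apply is_lim_seq_const.
  - apply is_lim_seq_plus'; [exact Hf | apply is_lim_seq_const]. }
simpl in H; lra.
Qed.

Lemma clim_inv (f : nat -> C) (l : C) (c : R) : (0 < c)%R ->
  filterlim f eventually (locally l) -> (forall n, c <= Cmod (f n))%R ->
  filterlim (fun n => / f n) eventually (locally (/ l)).
Proof.
intros Hc Hf Hb.
assert (Hl := clim_bounded_below f l c Hf Hb).
assert (Hn : forall z, (c <= Cmod z)%R -> z <> 0).
{ intros z Hz ->; rewrite Cmod_0 in Hz; lra. }
apply clim_iff_dist in Hf.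
apply clim_dist_le with (fun n => / c * / c * Cmod (f n - l))%R.
- intros n.
  replace (/ f n - / l) with (- (/ f n * / l * (f n - l)))
    by (field; split; apply Hn; auto).
  rewrite Cmod_opp, !Cmod_mult, !Cmod_inv by (apply Hn; auto).
  apply Rmult_le_compat_r; [apply Cmod_ge_0|].
  apply Rmult_le_compat; try (left; apply Rinv_0_lt_compat;
    eapply Rlt_le_trans; [exact Hc|]; auto);
  apply Rinv_le_contravar; auto.
- replace (Finite 0%R) with (Finite (/ c * / c * 0)%R) by (f_equal; ring).
  exact (is_lim_seq_scal_l _ _ 0%R Hf).
Qed.

(** * Bounds uniform in the number of factors *)

(** The Weierstrass inequality prod (1-t_k) >= 1 - sum t_k for t_k in [0,1],
    at t_k = |x| q^k. *)
Lemma one_minus_sum_le_qpoch (x : C) (q : R) (n : nat) : (0 < q < 1)%R ->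
  (Cmod x <= 1)%R ->
  (1 - Cmod x * ((1 - q ^ n) / (1 - q)) <= Cmod (qpoch x q n))%R.
Proof.
intros Hq Hx; assert (Hx0 := Cmod_ge_0 x).
induction n as [|n IH].
- simpl; rewrite Cmod_1; apply Req_le; field; lra.
- rewrite qpoch_S, Cmod_mult.
  assert (Hp : (0 < q ^ n <= 1)%R)
    by (split; [apply pow_lt; lra | rewrite <- (pow1 n); apply pow_incr; lra]).
  set (s := (Cmod x * ((1 - q ^ n) / (1 - q)))%R) in *.
  replace (Cmod x * ((1 - q ^ S n) / (1 - q)))%R with (s + Cmod x * q ^ n)%R
    by (unfold s; simpl; field; lra).
  assert (Hs : (0 <= s)%R).
  { unfold s, Rdiv; apply Rmult_le_pos; [exact Hx0|].
    apply Rmult_le_pos; [lra | left; apply Rinv_0_lt_compat; lra]. }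
  assert (Ht : (0 <= Cmod x * q ^ n <= 1)%R) by (split; nra).
  assert (Hf : (1 - Cmod x * q ^ n <= Cmod (1 - x * q ^ n))%R).
  { assert (T := Cmod_triangle (1 - x * q ^ n) (x * q ^ n)).
    replace (1 - x * q ^ n + x * q ^ n) with (RtoC 1) in T by ring.
    rewrite Cmod_1, Cmod_mult, <- RtoC_pow, Cmod_R, Rabs_pos_eq in T by lra.
    rewrite <- RtoC_pow in *; lra. }
  assert (G := Cmod_ge_0 (qpoch x q n)).
  apply Rle_trans with (Cmod (qpoch x q n) * (1 - Cmod x * q ^ n))%R;
    [nra | apply Rmult_le_compat_l; assumption].
Qed.

(** Once |x| q^K <= (1-q)/2 the product of the factors from K on is at least
    1/2 in modulus by [one_minus_sum_le_qpoch]; the K first factors are put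
    back one at a time. This gives both the boundedness of 1/(x)_n and the
    nonvanishing of (x)_oo. *)
Lemma qpoch_bounded_below (x : C) (q : R) : (0 < q < 1)%R ->
  (forall k, 1 - x * q ^ k <> 0) ->
  exists c : R, (0 < c)%R /\ forall n, (c <= Cmod (qpoch x q n))%R.
Proof.
intros Hq Hx.
assert (HK : exists K, (Cmod (x * q ^ K) <= (1 - q) / 2)%R).
{ assert (L := is_lim_seq_scal_l _ (Cmod x) 0%R
    (is_lim_seq_geom q ltac:(rewrite Rabs_pos_eq; lra))).
  simpl in L; rewrite Rmult_0_r in L; apply is_lim_seq_spec in L.
  destruct (L (mkposreal ((1 - q) / 2) ltac:(lra))) as [K HK].
  exists K; specialize (HK K (le_n K)); simpl in HK.
  rewrite Rminus_0_r in HK.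
  rewrite Cmod_mult, <- RtoC_pow, Cmod_R.
  rewrite Rabs_mult in HK; rewrite (Rabs_pos_eq (Cmod x)) in HK
    by apply Cmod_ge_0; lra. }
destruct HK as [K HK]; revert x Hx HK.
induction K as [|K IH]; intros x Hx HK.
- exists (/ 2)%R; split; [lra|]; intros n.
  simpl in HK; rewrite Cmult_1_r in HK.
  eapply Rle_trans; [|apply one_minus_sum_le_qpoch; [exact Hq | lra]].
  assert (Hp : (0 < q ^ n)%R) by (apply pow_lt; lra).
  assert (Cmod x * ((1 - q ^ n) / (1 - q)) <= / 2)%R; [|lra].
  assert (Hd : ((1 - q ^ n) / (1 - q) <= 1 / (1 - q))%R).
  { apply Rmult_le_compat_r; [left; apply Rinv_0_lt_compat|]; lra. }
  apply Rle_trans with (Cmod x * (1 / (1 - q)))%R;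
    [apply Rmult_le_compat_l; [apply Cmod_ge_0 | exact Hd]|].
  apply Rle_trans with ((1 - q) / 2 * (1 / (1 - q)))%R;
    [|apply Req_le; field; lra].
  apply Rmult_le_compat_r; [|exact HK].
  apply Rlt_le, Rdiv_lt_0_compat; lra.
- destruct (IH (x * q)) as [c [Hc Hb]].
  + intros k; rewrite <- Cmult_assoc, <- Cpow_S; apply Hx.
  + now rewrite <- Cmult_assoc, <- Cpow_S.
  + assert (H0 : (0 < Cmod (1 - x))%R).
    { apply Cmod_gt_0; specialize (Hx O); simpl in Hx.
      now rewrite Cmult_1_r in Hx. }
    exists (Rmin 1 (Cmod (1 - x) * c)); split.
    * apply Rmin_glb_lt; [lra | now apply Rmult_lt_0_compat].
    * intros [|n]; [simpl; rewrite Cmod_1; apply Rmin_l|].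
      rewrite qpoch_S_l, Cmod_mult.
      eapply Rle_trans; [apply Rmin_r|].
      apply Rmult_le_compat_l; [apply Cmod_ge_0 | apply Hb].
Qed.

(** Each factor pair has |(a-p)(b-p)| <= |ab| + s p with p = q^k, hence is at
    most rho (1 + (s/rho) q^(k-1)) for rho >= |ab|; the second factors multiply
    to the q-product (-s/rho)_n, bounded by [Cmod_qpoch_le]. Taking rho halfway between |ab| and
    1 also keeps it positive when ab = 0. *)
Lemma shifted_prod_bound (a b : C) (q : R) : (0 < q < 1)%R ->
  (Cmod (a * b) < 1)%R ->
  exists D rho : R, (0 < D)%R /\ (0 < rho < 1)%R /\
    forall n, (Cmod (shifted_prod a q n * shifted_prod b q n) <= D * rho ^ n)%R.
Proof.
intros Hq Hab.
assert (Ga := Cmod_ge_0 a); assert (Gb := Cmod_ge_0 b).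
assert (Gab := Cmod_ge_0 (a * b)).
set (s := (Cmod a + Cmod b + 1)%R).
set (rho := ((1 + Cmod (a * b)) / 2)%R).
assert (Hr : (0 < rho < 1)%R) by (unfold rho; lra).
assert (Hs : (0 <= s / rho)%R)
  by (apply Rlt_le, Rdiv_lt_0_compat; unfold s; lra).
exists (exp (s / rho / (1 - q))), rho; split; [apply exp_pos|].
split; [exact Hr|]; intros n.
apply Rle_trans with (Cmod (qpoch (- (s / rho))%R q n) * rho ^ n)%R.
2:{ apply Rmult_le_compat_r; [apply pow_le; lra|].
    eapply Rle_trans; [apply Cmod_qpoch_le; lra|].
    rewrite Cmod_R, Rabs_Ropp, Rabs_pos_eq by exact Hs; lra. }
induction n as [|n IH]; [simpl; rewrite Cmult_1_r, Cmod_1; lra|].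
cbn [shifted_prod]; rewrite qpoch_S.
replace (shifted_prod a q n * (a - q ^ S n) * (shifted_prod b q n * (b - q ^ S n)))
  with (shifted_prod a q n * shifted_prod b q n * ((a - q ^ S n) * (b - q ^ S n)))
  by ring.
rewrite (Cmod_mult (_ * _) (_ * _)), (Cmod_mult (qpoch _ _ _)).
replace (Cmod (qpoch (- (s / rho))%R q n) *
   Cmod (1 - (- (s / rho))%R * q ^ n) * rho ^ S n)%R
  with (Cmod (qpoch (- (s / rho))%R q n) * rho ^ n *
   (Cmod (1 - (- (s / rho))%R * q ^ n) * rho))%R by (simpl; ring).
apply Rmult_le_compat; [apply Cmod_ge_0 | apply Cmod_ge_0 | exact IH |].
rewrite <- !RtoC_pow, <- RtoC_mult, <- RtoC_minus, Cmod_R.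
assert (Hp : (0 < q ^ n <= 1)%R)
  by (split; [apply pow_lt; lra | rewrite <- (pow1 n); apply pow_incr; lra]).
assert (Hp' : (0 < q ^ S n <= q ^ n)%R) by (simpl; split; nra).
rewrite Rabs_pos_eq by nra.
replace ((1 - - (s / rho) * q ^ n) * rho)%R with (rho + s * q ^ n)%R
  by (field; lra).
set (p := (q ^ S n)%R) in *.
replace ((a - p) * (b - p)) with (a * b + p * (p - a - b)) by ring.
eapply Rle_trans; [apply Cmod_triangle|].
apply Rplus_le_compat; [unfold rho; lra|].
rewrite Cmod_mult, Cmod_R, Rabs_pos_eq by lra.
assert (Ht : (Cmod (p - a - b) <= s)%R).
{ unfold Cminus; eapply Rle_trans; [apply Cmod_triangle|].
  assert (T := Cmod_triangle p (- a)); rewrite !Cmod_opp, Cmod_R in *.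
  rewrite Rabs_pos_eq in T by lra; unfold s; lra. }
assert (G := Cmod_ge_0 (p - a - b)); nra.
Qed.

(** 2/(1-q) is the fixed point of t -> q t + 2, which dominates the recurrence
    of [theta_trunc_S]. *)
Lemma theta_trunc_bound (q : R) (n : nat) : (0 < q < 1)%R ->
  (Cmod (theta_trunc q n) <= 2 / (1 - q))%R.
Proof.
intros Hq; induction n as [|n IH].
- rewrite theta_trunc_O, Cmod_1; apply Rle_div_r; lra.
- rewrite theta_trunc_S by lra.
  eapply Rle_trans; [apply Cmod_triangle|].
  rewrite !Cmod_mult, <- !RtoC_pow, !Cmod_R.
  rewrite pow_1_abs, (Rabs_pos_eq 2), (Rabs_pos_eq (q ^ _)) by (try apply pow_le; lra).
  assert (Hp : (0 <= q ^ (2 * n + 1) <= q)%R).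
  { split; [apply pow_le; lra|]; rewrite Nat.add_1_r; simpl.
    assert (q ^ (n + (n + 0)) <= 1)%R
      by (rewrite <- (pow1 (n + (n + 0))); apply pow_incr; lra); nra. }
  replace (2 / (1 - q))%R with (q * (2 / (1 - q)) + 2)%R at 1 by (field; lra).
  assert (G := Cmod_ge_0 (theta_trunc q n)); nra.
Qed.

(** * Tannery's theorem *)

(** Cut at K: for fixed K the head tends to 0, and the rest is at most D times
    the tail of the series of x. *)
Lemma tannery_pos (x : nat -> R) (y : nat -> nat -> R) (D : R) :
  (forall n, 0 <= x n)%R -> ex_series x ->
  (forall N n, (n <= N)%nat -> (0 <= y N n <= D)%R) ->
  (forall n, is_lim_seq (fun N => y N n) 0%R) ->
  is_lim_seq (fun N => sum_n (fun n => x n * y N n)%R N) 0%R.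
Proof.
intros Hx [L HL] Hy Hlim.
assert (HL' : is_lim_seq (sum_n x) L) by exact HL.
assert (HD : (0 <= D)%R) by (specialize (Hy O O (le_n O)); lra).
assert (Hle : forall n, (sum_n x n <= L)%R).
{ intros n; apply (is_lim_seq_incr_compare _ _ HL').
  intros k; rewrite sum_Sn; unfold plus; simpl; specialize (Hx (S k)); lra. }
assert (Hpos : forall N k, (k <= N)%nat -> (0 <= sum_n (fun n => x n * y N n)%R k)%R).
{ intros N k; induction k as [|k IH]; intros Hk.
  - rewrite sum_O; apply Rmult_le_pos; [apply Hx | apply Hy, Hk].
  - rewrite sum_Sn; unfold plus; simpl.
    apply Rplus_le_le_0_compat; [apply IH; lia|].
    apply Rmult_le_pos; [apply Hx | apply Hy, Hk]. }
assert (Hfin : forall k, is_lim_seq (fun N => sum_n (fun n => x n * y N n)%R k) 0%R).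
{ intros k; induction k as [|k IH].
  - apply is_lim_seq_ext with (fun N => x O * y N O)%R;
      [intros; now rewrite sum_O|].
    replace 0%R with (x O * 0)%R by ring.
    apply is_lim_seq_mult'; [apply is_lim_seq_const | apply Hlim].
  - apply is_lim_seq_ext with
      (fun N => sum_n (fun n => x n * y N n)%R k + x (S k) * y N (S k))%R;
      [intros; now rewrite sum_Sn|].
    replace 0%R with (0 + x (S k) * 0)%R by ring.
    apply is_lim_seq_plus'; [exact IH|].
    apply is_lim_seq_mult'; [apply is_lim_seq_const | apply Hlim]. }
assert (Htail : forall N K d, (K + d <= N)%nat ->
  (sum_n (fun n => x n * y N n)%R (K + d) <=
   sum_n (fun n => x n * y N n)%R K + D * (sum_n x (K + d) - sum_n x K))%R).
{ intros N K d; induction d as [|d IH]; intros Hd.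
  - rewrite Nat.add_0_r, Rminus_diag, Rmult_0_r, Rplus_0_r; apply Rle_refl.
  - rewrite Nat.add_succ_r, !sum_Sn; unfold plus; simpl.
    specialize (IH ltac:(lia)); specialize (Hx (S (K + d))).
    specialize (Hy N (S (K + d)) ltac:(lia)); nra. }
apply is_lim_seq_spec; intros eps; assert (He := cond_pos eps).
apply is_lim_seq_spec in HL'.
assert (Hd : (0 < eps / (2 * (D + 1)))%R) by (apply Rdiv_lt_0_compat; lra).
destruct (HL' (mkposreal _ Hd)) as [K HK].
specialize (HK K (le_n K)); simpl in HK.
assert (Hf := Hfin K); apply is_lim_seq_spec in Hf.
destruct (Hf (pos_div_2 eps)) as [M HM].
exists (M + K)%nat; intros N HN.
specialize (HM N ltac:(lia)); simpl in HM; rewrite Rminus_0_r in *.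
rewrite Rabs_pos_eq in HM by (apply Hpos; lia).
rewrite Rabs_pos_eq by (apply Hpos; lia).
specialize (Htail N K (N - K)%nat ltac:(lia)).
replace (K + (N - K))%nat with N in Htail by lia.
rewrite Rabs_minus_sym, Rabs_pos_eq in HK by (specialize (Hle K); lra).
assert (HT : (D * (sum_n x N - sum_n x K) <= eps / 2)%R).
{ specialize (Hle N).
  apply Rle_trans with ((D + 1) * (eps / (2 * (D + 1))))%R;
    [|apply Req_le; field; lra].
  apply Rle_trans with (D * (eps / (2 * (D + 1))))%R; [|nra].
  apply Rmult_le_compat_l; lra. }
lra.
Qed.

Lemma Cmod_sum_le (f : nat -> C) (n : nat) :
  (Cmod (sum_n f n) <= sum_n (fun k => Cmod (f k)) n)%R.
Proof. exact (norm_sum_n_m (K := C_AbsRing) (V := C_NormedModule) f 0 n). Qed.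

(** Subtracting l from the factor v reduces to a limit 0. *)
Lemma tannery (u : nat -> C) (v : nat -> nat -> C) (S l : C) (D : R) :
  ex_series (fun n => Cmod (u n)) -> is_series u S ->
  (forall N n, (n <= N)%nat -> (Cmod (v N n) <= D)%R) ->
  (forall n, filterlim (fun N => v N n) eventually (locally l)) ->
  filterlim (fun N => sum_n (fun n => u n * v N n) N) eventually
    (locally (S * l)).
Proof.
intros Hu HS Hv Hl.
assert (HS' : filterlim (sum_n u) eventually (locally S)) by exact HS.
apply clim_iff_dist in HS'.
apply clim_dist_le with (fun N =>
  sum_n (fun n => Cmod (u n) * Cmod (v N n - l))%R N
  + Cmod (sum_n u N - S) * Cmod l)%R.
- intros N.
  replace (sum_n (fun n => u n * v N n) N - S * l)
    with (sum_n (fun n => u n * (v N n - l)) N + (sum_n u N - S) * l).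
  + eapply Rle_trans; [apply Cmod_triangle|].
    rewrite Cmod_mult; apply Rplus_le_compat_r.
    eapply Rle_trans; [apply Cmod_sum_le|].
    apply Req_le, sum_n_ext; intros n; apply Cmod_mult.
  + rewrite (csum_ext (fun n => u n * (v N n - l))
      (fun n => u n * v N n - l * u n)) by (intros; ring).
    rewrite csum_minus, csum_scal; ring.
- replace 0%R with (0 + 0 * Cmod l)%R by ring.
  apply is_lim_seq_plus'.
  + apply (tannery_pos _ (fun N n => Cmod (v N n - l)) (D + Cmod l)).
    * intros; apply Cmod_ge_0.
    * exact Hu.
    * intros N n Hn; split; [apply Cmod_ge_0|].
      unfold Cminus; eapply Rle_trans; [apply Cmod_triangle|].
      rewrite Cmod_opp; apply Rplus_le_compat_r; auto.
    * intros n; now apply clim_iff_dist.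
  + apply is_lim_seq_mult'; [exact HS' | apply is_lim_seq_const].
Qed.

(** * Summability of the two series *)

Lemma geometric_domination (u : nat -> C) (D rho : R) : (0 < rho < 1)%R ->
  (forall n, Cmod (u n) <= D * rho ^ n)%R ->
  ex_series (fun n => Cmod (u n)) /\
  ex_series (V := C_NormedModule) u.
Proof.
intros Hr Hu.
assert (Hg : ex_series (fun n => D * rho ^ n)%R).
{ apply (ex_series_scal_l (K := R_AbsRing) (V := R_NormedModule)).
  apply ex_series_geom; rewrite Rabs_pos_eq; lra. }
split.
- apply (ex_series_le (V := R_CompleteNormedModule) _ (fun n => D * rho ^ n)%R);
    [|exact Hg].
  intros n; change (Rabs (Cmod (u n)) <= D * rho ^ n)%R.
  rewrite Rabs_pos_eq by apply Cmod_ge_0; apply Hu.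
- exact (ex_series_le (V := C_CompleteNormedModule) u _ Hu Hg).
Qed.

Lemma lhs_term_eq (a b : C) (q : R) (n : nat) :
  lhs_term a b q n = shifted_prod a q n * shifted_prod b q n * (-1) ^ n
    / qpoch (q ^ 2)%R (q ^ 2) n.
Proof. unfold lhs_term; now rewrite !qpoch_pow_eq. Qed.

Lemma rhs_term_eq (a b : C) (q : R) (n : nat) :
  rhs_term a b q n = shifted_prod a q n * shifted_prod b q n
    * (1 - q ^ (2 * n + 1)) * theta_trunc q n
    / (qpoch (q * a) q n * qpoch (q * b) q n).
Proof.
unfold rhs_term, theta_trunc; cbv zeta; rewrite !qpoch_pow_eq.
transitivity (shifted_prod a q n * shifted_prod b q n * (1 - q ^ (2 * n + 1))
  / (qpoch (q * a) q n * qpoch (q * b) q n)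
  * sum_n (fun i => RtoC (powerRZ (-1) (Z.of_nat i - Z.of_nat n)
   * powerRZ q (Z.of_nat n ^ 2 - (Z.of_nat i - Z.of_nat n) ^ 2))) (2 * n)).
- rewrite <- csum_scal; apply csum_ext; intros i _.
  rewrite RtoC_mult; unfold Cdiv; ring.
- unfold Cdiv; ring.
Qed.

Lemma base_square_neq_0 (q : R) (k : nat) : (0 < q < 1)%R ->
  1 - RtoC (q ^ 2) * RtoC (q ^ 2) ^ k <> 0.
Proof.
intros Hq; rewrite <- Cpow_S; apply one_minus_pow_neq_0; simpl; split; nra.
Qed.

Lemma Cmod_div_le (x y : C) (X c : R) : (0 < c)%R ->
  (Cmod x <= X)%R -> (c <= Cmod y)%R -> (Cmod (x / y) <= X / c)%R.
Proof.
intros Hc Hx Hy.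
assert (y <> 0) by (intros ->; rewrite Cmod_0 in Hy; lra).
rewrite Cmod_div by assumption; assert (G := Cmod_ge_0 x).
apply Rmult_le_compat; try assumption.
- left; apply Rinv_0_lt_compat; lra.
- now apply Rinv_le_contravar.
Qed.

Lemma lhs_dominated (a b : C) (q : R) : (0 < q < 1)%R ->
  (Cmod (a * b) < 1)%R ->
  ex_series (fun n => Cmod (lhs_term a b q n)) /\
  ex_series (V := C_NormedModule) (lhs_term a b q).
Proof.
intros Hq Hab.
destruct (shifted_prod_bound a b q Hq Hab) as (D & rho & HD & Hr & Hb).
destruct (qpoch_bounded_below (q ^ 2)%R (q ^ 2)) as (c & Hc & Hbc).
{ simpl; split; nra. }
{ intros k; now apply base_square_neq_0. }
apply (geometric_domination _ (D / c) rho Hr); intros n.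
rewrite lhs_term_eq.
replace (D / c * rho ^ n)%R with (D * rho ^ n / c)%R by (unfold Rdiv; ring).
apply Cmod_div_le; auto.
rewrite Cmod_mult, Cmod_pow, Cmod_R, Rabs_m1, pow1, Rmult_1_r; auto.
Qed.

Lemma rhs_dominated (a b : C) (q : R) : (0 < q < 1)%R ->
  (Cmod (a * b) < 1)%R ->
  (forall k, 1 - q * a * q ^ k <> 0) -> (forall k, 1 - q * b * q ^ k <> 0) ->
  ex_series (fun n => Cmod (rhs_term a b q n)) /\
  ex_series (V := C_NormedModule) (rhs_term a b q).
Proof.
intros Hq Hab Ha Hb.
destruct (shifted_prod_bound a b q Hq Hab) as (D & rho & HD & Hr & HB).
destruct (qpoch_bounded_below (q * a) q Hq Ha) as (c & Hc & Hbc).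
destruct (qpoch_bounded_below (q * b) q Hq Hb) as (d & Hd & Hbd).
apply (geometric_domination _ (D * (2 / (1 - q)) / (c * d)) rho Hr); intros n.
rewrite rhs_term_eq.
replace (D * (2 / (1 - q)) / (c * d) * rho ^ n)%R
  with (D * rho ^ n * 1 * (2 / (1 - q)) / (c * d))%R by (unfold Rdiv; ring).
apply Cmod_div_le; [now apply Rmult_lt_0_compat | |].
- rewrite (Cmod_mult _ (theta_trunc q n)), (Cmod_mult _ (1 - _)).
  apply Rmult_le_compat; try apply Cmod_ge_0;
    [apply Rmult_le_pos; apply Cmod_ge_0 | | now apply theta_trunc_bound].
  apply Rmult_le_compat; try apply Cmod_ge_0; [apply HB|].
  assert (Hp : (0 <= q ^ (2 * n + 1) <= 1)%R)
    by (split; [apply pow_le; lra |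
        rewrite <- (pow1 (2 * n + 1)); apply pow_incr; lra]).
  rewrite <- RtoC_pow, <- RtoC_minus, Cmod_R, Rabs_pos_eq; lra.
- rewrite Cmod_mult; apply Rmult_le_compat; auto; lra.
Qed.

(** * Infinite products and the theorem *)

Lemma qpoch_inv_lim (x : C) (q : R) : (0 < q < 1)%R ->
  (forall k, 1 - x * q ^ k <> 0) ->
  filterlim (fun n => / qpoch x q n) eventually (locally (/ qpoch_inf x q)).
Proof.
intros Hq Hx; destruct (qpoch_bounded_below x q Hq Hx) as (c & Hc & Hb).
apply (clim_inv _ _ c Hc); [|exact Hb].
apply qpoch_inf_correct; lra.
Qed.

Lemma qpoch_inf_neq_0 (x : C) (q : R) : (0 < q < 1)%R ->
  (forall k, 1 - x * q ^ k <> 0) -> qpoch_inf x q <> 0.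
Proof.
intros Hq Hx H0; destruct (qpoch_bounded_below x q Hq Hx) as (c & Hc & Hb).
assert (H := clim_bounded_below _ _ c (qpoch_inf_correct x q ltac:(lra)) Hb).
rewrite H0, Cmod_0 in H; lra.
Qed.

Lemma factor_neq_0 (q : R) (a : C) : (0 < q < 1)%R ->
  (forall k : nat, (1 <= k)%nat -> a <> / q ^ k) ->
  forall k, 1 - q * a * q ^ k <> 0.
Proof.
intros Hq Ha k H; apply (Ha (S k)); [lia|].
assert (Hz : (q : C) ^ S k <> 0)
  by (apply Cpow_nz; intros E; apply RtoC_inj in E; lra).
replace a with ((q * a * q ^ k) / q ^ S k)
  by (rewrite Cpow_S in *; field; split; intros E; apply Hz; rewrite E; ring).
replace (q * a * q ^ k) with (1 - (1 - q * a * q ^ k)) by ring.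
rewrite H; field; exact Hz.
Qed.

Theorem theorem1p9 :
  forall (q : R) (a b : C),
  (0 < q < 1)%R ->
  (Cmod (a * b) < 1)%R ->
  (forall k : nat, (1 <= k)%nat -> a <> / q ^ k) ->
  (forall k : nat, (1 <= k)%nat -> b <> / q ^ k) ->
  exists S T : C,
    is_series (lhs_term a b q) S /\
    is_series (rhs_term a b q) T /\
    (qpoch_inf q q * qpoch_inf (a * b) q)
      / (qpoch_inf (q * a) q * qpoch_inf (q * b) q) * S = T.
Proof.
intros q a b Hq Hab Ha Hb.
assert (Ha' := factor_neq_0 q a Hq Ha); assert (Hb' := factor_neq_0 q b Hq Hb).
assert (Hq' : forall k, 1 - (q : C) * q ^ k <> 0)
  by (intros k; rewrite <- Cpow_S; now apply one_minus_pow_neq_0).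
destruct (lhs_dominated a b q Hq Hab) as [HuA [S HS]].
destruct (rhs_dominated a b q Hq Hab Ha' Hb') as [HtA [T HT]].
exists S, T; split; [exact HS|]; split; [exact HT|].
destruct (qpoch_bounded_below q q Hq Hq') as (c & Hc & Hbc).
assert (Hinv := qpoch_inv_lim q q Hq Hq').
assert (Hlim := fun x => qpoch_inf_correct x q ltac:(lra)).
assert (HL : filterlim (fun N => sum_n (fun n => lhs_term a b q n
    * (qpoch (a * b) q (N - n) / qpoch q q (N - n))) N) eventually
  (locally (S * (qpoch_inf (a * b) q * / qpoch_inf q q)))).
{ apply tannery with (D := (exp (Cmod (a * b) / (1 - q)) / c)%R); auto.
  - intros N n _; apply Cmod_div_le; auto; apply Cmod_qpoch_le; lra.
  - intros n.
    apply (clim_mult (fun N => qpoch (a * b) q (N - n))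
      (fun N => / qpoch q q (N - n)));
    [apply (clim_shift (qpoch (a * b) q) _ (fun N => N - n)%nat n)
    |apply (clim_shift (fun N => / qpoch q q N) _ (fun N => N - n)%nat n)];
    auto; intros; lia. }
assert (HR : filterlim (fun N => sum_n (fun n => rhs_term a b q n
    * / (qpoch q q (N - n) * qpoch q q (N + n + 1))) N) eventually
  (locally (T * (/ qpoch_inf q q * / qpoch_inf q q)))).
{ apply tannery with (D := (/ (c * c))%R); auto.
  - intros N n _.
    replace (/ (qpoch q q (N - n) * qpoch q q (N + n + 1)))
      with (1 / (qpoch q q (N - n) * qpoch q q (N + n + 1)))
      by (unfold Cdiv; ring).
    rewrite <- (Rmult_1_l (/ (c * c))); apply Cmod_div_le.
    + now apply Rmult_lt_0_compat.
    + rewrite Cmod_1; lra.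
    + rewrite Cmod_mult; apply Rmult_le_compat; auto; lra.
  - intros n.
    apply (filterlim_ext (fun N => / qpoch q q (N - n) * / qpoch q q (N + n + 1))).
    { intros N; field; split; apply qfact_neq_0; exact Hq. }
    apply clim_mult;
    [apply (clim_shift (fun N => / qpoch q q N) _ (fun N => N - n)%nat n)
    |apply (clim_shift (fun N => / qpoch q q N) _ (fun N => N + n + 1)%nat n)];
    auto; intros; lia. }
assert (HR' := clim_mult _ _ _ _
  (clim_mult _ _ _ _ (Hlim (q * a)) (Hlim (q * b))) HR).
assert (E : S * (qpoch_inf (a * b) q * / qpoch_inf q q)
  = qpoch_inf (q * a) q * qpoch_inf (q * b) q
    * (T * (/ qpoch_inf q q * / qpoch_inf q q))).
{ apply (filterlim_locally_unique (K := C_AbsRing) (V := C_NormedModule)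
    (F := eventually) _ _ _ HL).
  revert HR'; apply filterlim_ext; intros N.
  rewrite (csum_ext _ _ N (fun n _ => f_equal (fun z => z * / (qpoch q q (N - n)
    * qpoch q q (N + n + 1))) (rhs_term_eq a b q n))).
  rewrite (csum_ext (fun n => lhs_term a b q n * _) _ N (fun n _ =>
    f_equal (fun z => z * (qpoch (a * b) q (N - n) / qpoch q q (N - n)))
      (lhs_term_eq a b q n))).
  symmetry; apply finite_identity; [exact Hq | |];
    intros n; now apply qpoch_neq_0. }
assert (Nq := qpoch_inf_neq_0 q q Hq Hq').
assert (Na := qpoch_inf_neq_0 (q * a) q Hq Ha').
assert (Nb := qpoch_inf_neq_0 (q * b) q Hq Hb').
transitivity (S * (qpoch_inf (a * b) q * / qpoch_inf q q)
  * (qpoch_inf q q * qpoch_inf q q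
     / (qpoch_inf (q * a) q * qpoch_inf (q * b) q))).
- field; auto.
- rewrite E; field; auto.
Qed.
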